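(* Let $\alpha\in[0,1]$. (a) Let $G_1$ and $G_2$ be regular graphs and let $H$ be an arbitrary graph. If $G_1$ and $G_2$ are $A_\alpha$-cospectral, then $G_1\underline\vee_Q H$ and $G_2\underline\vee_Q H$ are $A_\alpha$-cospectral. (b) Let $G$ be a regular graph and let $H_1$ and $H_2$ be graphs with $\Upsilon_{A_\alpha(H_1)}(\nu)=\Upsilon_{A_\alpha(H_2)}(\nu)$. If $H_1$ and $H_2$ are $A_\alpha$-cospectral, then $G\underline\vee_Q H_1$ and $G\underline\vee_Q H_2$ are $A_\alpha$-cospectral.
   Context: All graphs are finite, undirected and simple. For a graph $G$ with adjacency matrix $A(G)$ and diagonal degree matrix $D(G)$, put $A_\alpha(G)=\alpha D(G)+(1-\alpha)A(G)$. The $A_\alpha$-spectrum of $G$ is the multiset of eigenvalues of $A_\alpha(G)$. Two non-isomorphic graphs possessing the same $A_\alpha$-spectrum are called $A_\alpha$-cospectral. For an $n\times n$ matrix $M$, the $M$-coronal is the rational function $\Upsilon_M(\nu)=\mathbf 1_n^T(\nu I_n-M)^{-1}\mathbf 1_n$, where $\mathbf 1_n$ is the all-ones column vector. The $Q$-graph $\mathcal Q(G)$ is obtained from $G$ by inserting a new vertex into each edge of $G$ (so each edge is subdivided: the new vertex is adjacent to the two ends of the edge, and the original edge is no longer present), and then making two new vertices adjacent whenever they lie on adjacent edges of $G$ (distinct edges sharing an endpoint). The $Q$-edge join $G_1\underline\vee_Q G_2$ is obtained from the disjoint union of $\mathcal Q(G_1)$ and $G_2$ by joining each newly inserted vertex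 of $\mathcal Q(G_1)$ to every vertex of $G_2$. *)

(* Defs.v *)
From HB Require Import structures.
From mathcomp Require Import all_boot all_order all_algebra.
From mathcomp Require Import complex.
From mathcomp Require Import finmap multiset.

Set Implicit Arguments.
Unset Strict Implicit.
Unset Printing Implicit Defensive.

Import Order.TTheory GRing.Theory Num.Theory.
Local Open Scope ring_scope.

Record sgraph := SGraph {
  vertex :> finType;
  adj : rel vertex;
  adj_sym : symmetric adj;
  adj_irrefl : irreflexive adj }.

Definition degree (G : sgraph) (x : G) : nat := #|[set y | adj x y]|.

Definition regular (G : sgraph) : Prop :=
  exists r : nat, forall x : G, degree x = r.

Definition isomorphic (G H : sgraph) : Prop :=
  exists f : G -> H, bijective f /\ forall x y, adj (f x) (f y) = adj x y.

Definition is_edge (G : sgraph) (e : {set G}) : bool :=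
  [exists x, exists y, adj x y && (e == [set x; y])].

Definition edge (G : sgraph) : finType := {e : {set G} | is_edge e}.

(* [inl v] is an original vertex, [inr e] the vertex inserted into edge [e]. *)
Definition Qgraph_adj (G : sgraph) : rel (G + edge G)%type := fun x y =>
  match x, y with
  | inl _, inl _ => false
  | inl v, inr e | inr e, inl v => v \in val e
  | inr e, inr f => (e != f) && (val e :&: val f != set0)
  end.

Lemma Qgraph_adj_sym (G : sgraph) : symmetric (@Qgraph_adj G).
Proof. by move=> [v|e] [w|f] //=; rewrite eq_sym setIC. Qed.

Lemma Qgraph_adj_irrefl (G : sgraph) : irreflexive (@Qgraph_adj G).
Proof. by move=> [v|e] //=; rewrite eqxx. Qed.

Definition Qgraph (G : sgraph) : sgraph :=
  SGraph (@Qgraph_adj_sym G) (@Qgraph_adj_irrefl G).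

Definition Qedge_join_adj (G1 G2 : sgraph) : rel (Qgraph G1 + G2)%type :=
  fun x y =>
  match x, y with
  | inl a, inl b => adj a b
  | inr u, inr v => adj u v
  | inl (inr _), inr _ | inr _, inl (inr _) => true
  | inl (inl _), inr _ | inr _, inl (inl _) => false
  end.

Lemma Qedge_join_adj_sym (G1 G2 : sgraph) : symmetric (@Qedge_join_adj G1 G2).
Proof. by move=> [[v|e]|x] [[w|f]|y] //; exact: adj_sym. Qed.

Lemma Qedge_join_adj_irrefl (G1 G2 : sgraph) :
  irreflexive (@Qedge_join_adj G1 G2).
Proof. by move=> [a|x]; [case: a => a|]; exact: adj_irrefl. Qed.

Definition Qedge_join (G1 G2 : sgraph) : sgraph :=
  SGraph (@Qedge_join_adj_sym G1 G2) (@Qedge_join_adj_irrefl G1 G2).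

Definition adjacency_mx (R : pzRingType) (G : sgraph) : 'M[R]_#|G| :=
  \matrix_(i, j) (adj (enum_val i) (enum_val j) : nat)%:R.

Definition degree_mx (R : pzRingType) (G : sgraph) : 'M[R]_#|G| :=
  diag_mx (\row_i (degree (enum_val i))%:R).

Definition Aalpha (R : pzRingType) (alpha : R) (G : sgraph) : 'M[R]_#|G| :=
  alpha *: degree_mx R G + (1 - alpha) *: adjacency_mx R G.

(* The eigenvalues are taken in the algebraic closure [R[i]], with algebraic
   multiplicity: they are the roots of the characteristic polynomial. *)
Definition spectrum (R : rcfType) (n : nat) (M : 'M[R]_n) : {mset R[i]}%mset :=
  seq_mset (sval (closed_field_poly_normal
    (char_poly (map_mx (real_complex R) M)))).

Definition Aalpha_cospectral (R : rcfType) (alpha : R) (G H : sgraph) : Prop :=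
  ~ isomorphic G H /\ spectrum (Aalpha alpha G) = spectrum (Aalpha alpha H).

(* The indeterminate nu is ['X] in the field of rational functions over [R]. *)
Definition coronal (R : fieldType) (n : nat) (M : 'M[R]_n) :
    {fraction {poly R}} :=
  let nuI_M := (tofrac 'X)%:M - map_mx (fun a : R => tofrac a%:P) M in
  ((const_mx 1 : 'cV_n)^T *m invmx nuI_M *m (const_mx 1 : 'cV_n)) 0 0.

(* Main.v *)
Require Import Defs.
From mathcomp Require Import all_boot all_order all_algebra.
From mathcomp Require Import complex multiset perm ring.

(* Spectra.  Let z = nu + alpha m, where m is the number of inserted vertices.  A
   Schur complement on the block of H gives
     det (z - A_alpha(G v_Q H)) = det (nu - A_alpha(H)) * det S,
   where S involves H only through its order and its coronal, which proves (b).
   If G is r-regular of order n with incidence matrix B, then the all-ones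
   matrix on the inserted vertices is B^T J B / 4, so after eliminating the
   vertices of G, Sylvester's identity turns det S into the determinant of a
   polynomial in B B^T = r + A(G) and J.  As J commutes with A(G), it splits off,
   and det S depends on G only through n, r, m and the characteristic polynomial
   of A_alpha(G).  As r is the largest eigenvalue of A_alpha(G), this proves (a).

   Isomorphisms.  An isomorphism between two joins can be corrected, by swapping
   twins, so that it preserves the set of original vertices of the Q-graphs.
   Then G is recovered from common neighbours of these vertices, and H as the
   part at distance at least 2 from them. *)

Set Implicit Arguments.
Unset Strict Implicit.
Unset Printing Implicit Defensive.
Import Order.TTheory GRing.Theory Num.Theory.
Local Open Scope ring_scope.

(** * Degrees in the join *)

Lemma degreeE (G : sgraph) (x : G) : degree x = (\sum_y adj x y)%N.
Proof.
by rewrite /degree -sum1dep_card big_mkcond; apply: eq_bigr => y _; case: adj.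
Qed.

Lemma edge_ends (G : sgraph) (e : edge G) :
  exists x y, adj x y /\ val e = [set x; y].
Proof.
by case: e => e /= /existsP[x /existsP[y /andP[xy /eqP->]]]; exists x, y.
Qed.

Lemma adj_neq (G : sgraph) (x y : G) : adj x y -> x != y.
Proof. by apply: contraTneq => ->; rewrite adj_irrefl. Qed.

Lemma card_edge (G : sgraph) (e : edge G) : #|val e| = 2%N.
Proof. by have [x [y [/adj_neq xy ->]]] := edge_ends e; rewrite cards2 xy. Qed.

Lemma edge_count (G : sgraph) (e : edge G) : (\sum_v (v \in val e))%N = 2%N.
Proof.
rewrite -(card_edge e) -sum1_card [RHS]big_mkcond.
by apply: eq_bigr => v _; case: (v \in _).
Qed.

Lemma is_edge_pair (G : sgraph) (x y : G) : is_edge [set x; y] = adj x y.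
Proof.
apply/existsP/idP => [[a /existsP[b /andP[ab /eqP exy]]]|xy]; last first.
  by exists x; apply/existsP; exists y; rewrite xy eqxx.
have nab := adj_neq ab.
have := set22 x y; have := set21 x y; rewrite exy !inE.
have /eqP := congr1 (fun A : {set G} => #|A|) exy; rewrite !cards2 nab.
case: eqVneq => // nxy _.
do 2![case/orP=> /eqP ?]; subst; rewrite ?eqxx // in nxy *.
by rewrite adj_sym.
Qed.

Lemma incident_count (G : sgraph) (v : G) :
  (\sum_(e : edge G) (v \in val e))%N = degree v.
Proof.
have -> : (\sum_(e : edge G) (v \in val e))%N
    = #|[set e : edge G | v \in val e]|.
  rewrite -sum1dep_card [RHS]big_mkcond.
  by apply: eq_bigr => e _; case: (_ \in _).
rewrite -(card_imset _ val_inj) /degree.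
rewrite -(@card_in_imset _ _ (fun y => [set v; y]) [set y | adj v y]).
  congr #|pred_of_set _|; apply/setP => A; apply/imsetP/imsetP => [[e]|[y]].
    rewrite inE => ve ->; have [x [y [xy ee]]] := edge_ends e.
    move: ve; rewrite ee !inE => /orP[] /eqP->.
      by exists y; rewrite ?inE.
    by exists x; rewrite ?inE 1?setUC // adj_sym.
  rewrite inE => vy ->; have ee : is_edge [set v; y] by rewrite is_edge_pair.
  by exists (exist (fun e : {set G} => is_edge e) _ ee); rewrite ?inE ?eqxx.
move=> y y'; rewrite !inE => /adj_neq vy /adj_neq vy' /setP/(_ y).
by rewrite !inE eqxx orbT eq_sym (negPf vy) => /esym/eqP.
Qed.

(** These are the entries of B^T B: distinct edges of a simple graph share at most one end, and the
    diagonal entries are 2. *)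
Lemma Qgraph_edge_adj (G : sgraph) (e f : edge G) :
  (@Qgraph_adj G (inr e) (inr f) + 2 * (e == f))%N = #|val e :&: val f|.
Proof.
rewrite /=; have [->|nef] /= := eqVneq e f; first by rewrite setIid card_edge.
rewrite addn0 -card_gt0.
suff : (#|val e :&: val f| < 2)%N by case: #|_| => [|[]].
rewrite ltn_neqAle -{2}(card_edge e) subset_leq_card ?subsetIl // andbT.
apply: contra nef => /eqP c2; apply/eqP/val_inj/eqP.
rewrite eqEcard !card_edge leqnn andbT.
by apply/setIidPl/eqP; rewrite eqEcard subsetIl c2 card_edge.
Qed.

Lemma sum_cardI_edge (G : sgraph) (r : nat) (e : edge G) :
  (forall x : G, degree x = r) ->
  (\sum_(f : edge G) #|val e :&: val f|)%N = (2 * r)%N.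
Proof.
move=> reg.
transitivity (\sum_(f : edge G) \sum_(v in val e) (v \in val f))%N.
  apply: eq_bigr => f _; rewrite -sum1_card big_mkcond [RHS]big_mkcond.
  by apply: eq_bigr => v _; rewrite inE; do 2!case: (v \in _).
rewrite exchange_big /= (eq_bigr (fun=> r)) => [|v _].
  by rewrite sum_nat_const card_edge.
by rewrite incident_count reg.
Qed.

Lemma handshake (G : sgraph) (r : nat) :
  (forall x : G, degree x = r) -> (2 * #|edge G|)%N = (#|G| * r)%N.
Proof.
move=> reg; transitivity (\sum_(e : edge G) \sum_v (v \in val e))%N.
  by rewrite (eq_bigr (fun=> 2%N)) ?sum_nat_const 1?mulnC // => e _;
    exact: edge_count.
rewrite exchange_big /= (eq_bigr (fun=> r)) ?sum_nat_const // => v _.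
by rewrite incident_count reg.
Qed.

Lemma eq_card_edge (G1 G2 : sgraph) (r : nat) :
  (forall x : G1, degree x = r) -> (forall x : G2, degree x = r) ->
  #|G1| = #|G2| -> #|edge G1| = #|edge G2|.
Proof.
move=> reg1 reg2 eqn; apply/eqP; rewrite -(eqn_pmul2l (ltn0Sn 1)).
by rewrite (handshake reg1) (handshake reg2) eqn.
Qed.

Lemma degree_Qjoin_vertex (G H : sgraph) (v : G) :
  degree (inl (inl v) : Qedge_join G H) = degree v.
Proof.
rewrite degreeE !big_sumType /= big1 // [X in (_ + X)%N]big1 // add0n addn0.
exact: incident_count.
Qed.

Lemma degree_Qjoin_edge (G H : sgraph) (r : nat) (e : edge G) :
  (forall x : G, degree x = r) ->
  degree (inl (inr e) : Qedge_join G H) = (2 * r + #|H|)%N.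
Proof.
move=> reg; rewrite degreeE !big_sumType /= [X in (_ + X)%N]sum1_card.
congr (_ + _)%N; rewrite -(sum_cardI_edge e reg) addnC.
under [RHS]eq_bigr do rewrite -Qgraph_edge_adj.
(* The two ends of [e], as neighbours of [e], make up for the diagonal term 2 of
   [Qgraph_edge_adj]. *)
rewrite big_split /=; congr (_ + _)%N.
rewrite -big_distrr /= (bigD1 e) //= eqxx [X in (1 + X)%N]big1.
  by rewrite muln1 edge_count.
by move=> f; rewrite eq_sym => /negPf->.
Qed.

Lemma degree_Qjoin_right (G H : sgraph) (h : H) :
  degree (inr h : Qedge_join G H) = (#|edge G| + degree h)%N.
Proof.
by rewrite degreeE !big_sumType /= big1 // add0n sum1_card -degreeE.
Qed.

(** * Isomorphisms of joins *)

Definition graph_iso (G H : sgraph) (f : G -> H) : Prop :=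
  bijective f /\ forall x y, adj (f x) (f y) = adj x y.

Lemma graph_iso_degree (G H : sgraph) (f : G -> H) (x : G) :
  graph_iso f -> degree (f x) = degree x.
Proof.
case=> bij_f adj_f; rewrite !degreeE (reindex f) /=; last exact: onW_bij.
by apply: eq_bigr => y _; rewrite adj_f.
Qed.

(** Swapping two vertices with the same neighbourhood is an automorphism of [G]. *)
Lemma twin_swap_iso (G H : sgraph) (f : G -> H) (v w : G) :
  graph_iso f -> (forall z, adj v z = adj w z) ->
  graph_iso (fun x => f (tperm v w x)).
Proof.
move=> [bij_f adj_f] twins; split.
  exact: (bij_comp bij_f (injF_bij (@perm_inj _ (tperm v w)))).
have adjl z y : adj (tperm v w z) y = adj z y by case: tpermP => // ->.
by move=> x y; rewrite adj_f adjl adj_sym adjl adj_sym.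
Qed.

Definition in_vertices (G H : sgraph) (x : Qedge_join G H) : bool :=
  if x is inl (inl _) then true else false.

Lemma card_in_vertices (G H : sgraph) :
  #|[set x | @in_vertices G H x]| = #|G|.
Proof.
rewrite -sum1dep_card big_mkcond !big_sumType /= sum1_card.
by rewrite !big1 // !addn0.
Qed.

(** An edge forces r > 0, so 2r + |H| > r. Hence an isomorphism never sends an inserted vertex to an
    original one. *)
Lemma degree_Qjoin_edge_gt (G H : sgraph) (r : nat) (e : edge G) :
  (forall x : G, degree x = r) ->
  (r < degree (inl (inr e) : Qedge_join G H))%N.
Proof.
move=> reg; rewrite (degree_Qjoin_edge _ _ reg).
have [x [y [xy _]]] := edge_ends e.
suff r0 : (0 < r)%N.
  by rewrite mul2n -addnn -addnA -{1}[r]addn0 ltn_add2l addn_gt0 r0.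
by rewrite -(reg x) /degree card_gt0; apply/set0Pn; exists y; rewrite inE.
Qed.

(* [h] is adjacent to all inserted vertices, so there are at most [r] of them;
   since [r] of them are adjacent to [v], they are exactly the neighbours of
   both. *)
Lemma low_degree_twin (G H : sgraph) (r : nat) (v : G) (h : H) :
  (forall x : G, degree x = r) -> degree (inr h : Qedge_join G H) = r ->
  forall z : Qedge_join G H,
    adj (inl (inl v) : Qedge_join G H) z = adj (inr h : Qedge_join G H) z.
Proof.
move=> reg; rewrite degree_Qjoin_right => dh.
have inc : (\sum_(e : edge G) (v \in val e) = r)%N by rewrite incident_count.
have [e _|] := @leqif_sum _ xpredT (fun e : edge G => v \in val e)
  (fun e => nat_of_bool (v \in val e)) (fun=> 1%N).
  by split; case: (v \in _).
rewrite inc sum1_card => le_r eq_all.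
have eqm : #|edge G| = r.
  by apply/eqP; rewrite eqn_leq le_r andbT -dh leq_addr.
have d0 : degree h = 0%N.
  by apply/eqP; rewrite -(eqn_add2l #|edge G|) dh addn0 eqm.
move: eq_all; rewrite eqm eqxx => /esym/forallP all_inc.
case=> [[w|e]|h'] //=; first exact: (all_inc e).
apply/esym/negbTE/negP => hh'; move: d0.
rewrite /degree => /eqP; rewrite cards_eq0 => /eqP/setP/(_ h').
by rewrite !inE hh'.
Qed.

(** Induction on the number of original vertices that [f] sends elsewhere; precomposing [f] with a
    swap of twins lowers it. *)
Lemma Qjoin_iso_vertices (G1 G2 H1 H2 : sgraph) (r : nat)
    (f : Qedge_join G1 H1 -> Qedge_join G2 H2) :
  (forall x : G1, degree x = r) -> (forall x : G2, degree x = r) ->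
  #|G1| = #|G2| -> graph_iso f ->
  exists2 g : Qedge_join G1 H1 -> Qedge_join G2 H2, graph_iso g &
    forall x, in_vertices (g x) = in_vertices x.
Proof.
move=> reg1 reg2 eqn.
have [k] := ubnP #|[set x | in_vertices x && ~~ in_vertices (f x)]|.
elim: k f => // k IHk f ltk iso_f.
pose A := [set x | @in_vertices G1 H1 x]; pose B := [set x | in_vertices (f x)].
have cAB : #|A| = #|B|.
  rewrite card_in_vertices eqn -(card_in_vertices _ H2).
  have [[f' fK f'K] _] := iso_f.
  rewrite -(card_imset _ (can_inj fK)); congr #|pred_of_set _|.
  apply/setP=> y; apply/idP/imsetP => [yV|[x]].
    by exists (f' y); rewrite ?f'K // inE f'K; rewrite inE in yV.
  by rewrite !inE => xB ->.
have [sAB|] := boolP (A \subset B).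
  exists f => // x; have /setP/(_ x) : A = B.
    by apply/eqP; rewrite eqEcard sAB cAB /=.
  by rewrite !inE.
case/subsetPn => v vA vB.
(* [A] and [B] have the same size, so each has a point outside the other. *)
have : ~~ (B \subset A).
  apply: contra vB => sBA; suff -> : B = A by [].
  by apply/eqP; rewrite eqEcard sBA cAB /=.
case/subsetPn => h hB hA; rewrite !inE in vA vB hB hA.
(* As [f h] is original, [h] has degree [r]; so it is not an inserted vertex, lies in [H1], and is a
   twin of [v]. *)
have deg_h : degree h = r.
  rewrite -(graph_iso_degree h iso_f).
  case: (f h) hB => [[w|]|] //= _; by rewrite degree_Qjoin_vertex reg2.
have twins : forall z, adj v z = adj h z.
  case: v vA {vB} => [[v|]|] // _.
  case: h hA deg_h {hB} => [[//|e]|h] _.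
    by have := degree_Qjoin_edge_gt H1 e reg1 => /[swap] ->; rewrite ltnn.
  by move=> dh z; rewrite (low_degree_twin v reg1 dh).
apply: (IHk (fun x => f (tperm v h x))); last exact: twin_swap_iso.
rewrite -ltnS; apply: leq_trans ltk; rewrite ltnS; apply: proper_card.
apply/properP; split; last first.
  by exists v; rewrite !inE vA ?tpermL ?hB.
apply/subsetP => x; rewrite !inE; case: tpermP => [->|->|//].
- by rewrite hB andbF.
- by rewrite (negbTE hA).
Qed.

(** * Recovering [G] and [H] from the join *)

Lemma Qjoin_iso_vertex_map (G1 G2 H1 H2 : sgraph)
    (g : Qedge_join G1 H1 -> Qedge_join G2 H2) :
  (forall x, in_vertices (g x) = in_vertices x) ->
  exists u : G1 -> G2, forall v, g (inl (inl v)) = inl (inl (u v)).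
Proof.
move=> gV.
have ex v : exists w, g (inl (inl v)) == inl (inl w).
  by case: (g _) (gV (inl (inl v))) => [[w|]|] // _; exists w.
by exists (fun v => xchoose (ex v)) => v; apply/eqP/(xchooseP (ex v)).
Qed.

Definition in_right (G H : sgraph) (x : Qedge_join G H) : bool :=
  if x is inr _ then true else false.

Lemma Qjoin_iso_right_map (G1 G2 H1 H2 : sgraph)
    (g : Qedge_join G1 H1 -> Qedge_join G2 H2) :
  (forall x, in_right (g x) = in_right x) ->
  exists u : H1 -> H2, forall v, g (inr v) = inr (u v).
Proof.
move=> gV.
have ex v : exists w, g (inr v) == inr w.
  by case: (g _) (gV (inr v)) => [|w] // _; exists w.
by exists (fun v => xchoose (ex v)) => v; apply/eqP/(xchooseP (ex v)).
Qed.

Lemma graph_iso_inv (G H : sgraph) (f : G -> H) :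
  graph_iso f -> exists2 g, graph_iso g & cancel f g /\ cancel g f.
Proof.
case=> [[g fK gK] adj_f]; exists g => //; split; first by exists f.
by move=> x y; rewrite -adj_f !gK.
Qed.

(** An original vertex is adjacent only to the inserted vertices of its edges, so a common neighbour
    of distinct [x] and [y] is the edge [[set x; y]]. *)
Lemma adj_common_neighbour (G H : sgraph) (x y : G) :
  adj x y = (x != y) && [exists z : Qedge_join G H,
    adj (inl (inl x) : Qedge_join G H) z &&
    adj (inl (inl y) : Qedge_join G H) z].
Proof.
apply/idP/andP => [xy|[nxy /existsP[[[//|e]|//] /andP[/= xe ye]]]].
  split; first exact: adj_neq.
  have ee : is_edge [set x; y] by rewrite is_edge_pair.
  apply/existsP; exists (inl (inr (exist (fun e : {set G} => is_edge e) _ ee))).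
  by rewrite /= !inE !eqxx orbT.
have [a [b [ab ee]]] := edge_ends e; move: xe ye nxy; rewrite ee !inE.
by do 2![case/orP=> /eqP->]; rewrite ?eqxx // adj_sym.
Qed.

Lemma Qjoin_iso_left (G1 G2 H1 H2 : sgraph) (r : nat) :
  (forall x : G1, degree x = r) -> (forall x : G2, degree x = r) ->
  #|G1| = #|G2| -> isomorphic (Qedge_join G1 H1) (Qedge_join G2 H2) ->
  isomorphic G1 G2.
Proof.
move=> reg1 reg2 eqn [f iso_f].
have [g iso_g gV] := Qjoin_iso_vertices reg1 reg2 eqn iso_f.
have [g' iso_g' [gK g'K]] := graph_iso_inv iso_g.
have g'V x : in_vertices (g' x) = in_vertices x by rewrite -gV g'K.
have [u uE] := Qjoin_iso_vertex_map gV.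
have [u' u'E] := Qjoin_iso_vertex_map g'V.
have uK : cancel u u'.
  by move=> v; have := u'E (u v); rewrite -uE gK => -[].
have u'K : cancel u' u.
  by move=> v; have := uE (u' v); rewrite -u'E g'K => -[].
exists u; split=> [|x y]; first by exists u'.
rewrite (adj_common_neighbour H2) (adj_common_neighbour H1) (can_eq uK).
congr (_ && _); have [bij_g adj_g] := iso_g.
apply/existsP/existsP => -[z]; rewrite -!uE.
  by rewrite -{1 2}[z]g'K !adj_g; exists (g' z).
by rewrite -!adj_g; exists (g z).
Qed.

(** An inserted vertex is adjacent to the ends of its edge, a vertex of [H] to no original vertex.
    Isomorphisms that preserve [in_vertices] thus preserve [in_right]. *)
Lemma in_right_Qjoin (G H : sgraph) (x : Qedge_join G H) :
  in_right x = ~~ in_vertices x && ~~ [exists y, in_vertices y && adj x y].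
Proof.
case: x => [[v|e]|h] //=; apply/esym.
  apply/negbTE; rewrite negbK; have [x [y [_ ee]]] := edge_ends e.
  by apply/existsP; exists (inl (inl x)); rewrite /= ee set21.
by apply/existsP => -[[[]|]].
Qed.

Lemma Qjoin_iso_right (G1 G2 H1 H2 : sgraph) (r : nat) :
  (forall x : G1, degree x = r) -> (forall x : G2, degree x = r) ->
  #|G1| = #|G2| -> isomorphic (Qedge_join G1 H1) (Qedge_join G2 H2) ->
  isomorphic H1 H2.
Proof.
move=> reg1 reg2 eqn [f iso_f].
have [g iso_g gV] := Qjoin_iso_vertices reg1 reg2 eqn iso_f.
have [g' iso_g' [gK g'K]] := graph_iso_inv iso_g.
have [bij_g adj_g] := iso_g.
have gH x : in_right (g x) = in_right x.
  rewrite !in_right_Qjoin gV; congr (_ && ~~ _).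
  apply/existsP/existsP => -[z].
    by rewrite -[z]g'K gV adj_g; exists (g' z).
  by rewrite -adj_g -gV; exists (g z).
have g'H x : in_right (g' x) = in_right x by rewrite -gH g'K.
have [u uE] := Qjoin_iso_right_map gH.
have [u' u'E] := Qjoin_iso_right_map g'H.
have uK : cancel u u'.
  by move=> v; have := u'E (u v); rewrite -uE gK => -[].
have u'K : cancel u' u.
  by move=> v; have := uE (u' v); rewrite -u'E g'K => -[].
exists u; split=> [|x y]; first by exists u'.
by have := adj_g (inr x) (inr y); rewrite !uE.
Qed.

(** * Determinants and characteristic polynomials *)

(** Rows and columns undergo the same permutation, so the signs cancel. Two sizes appear because the
    order of a sum type is only propositionally the sum of the orders. *)
Lemma det_mxsub_bij (R : comNzRingType) (m n : nat) (g : 'I_m -> 'I_n)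
    (A : 'M[R]_n) :
  m = n -> injective g -> \det (mxsub g g A) = \det A.
Proof.
move=> eqmn; subst m => inj_g.
have -> : mxsub g g A = row_perm (perm inj_g) (col_perm (perm inj_g) A).
  by apply/matrixP => i j; rewrite !mxE !permE.
rewrite row_permE col_permE !det_mulmx !det_perm mulrCA -signr_addb.
by rewrite odd_permV addbb mulr1.
Qed.

(** Right multiplication by the unipotent matrix with lower left block [- (invmx D *m C)] clears
    [C]. *)
Lemma det_block_schur (F : fieldType) (m n : nat) (A : 'M[F]_m)
    (B : 'M_(m, n)) (C : 'M_(n, m)) (D : 'M_n) :
  D \in unitmx ->
  \det (block_mx A B C D) = \det D * \det (A - B *m invmx D *m C).
Proof.
move=> uD; have := det_lblock (1%:M : 'M[F]_m) (- (invmx D *m C)) (1%:M : 'M_n).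
rewrite !det1 mulr1 => det_l.
rewrite -[LHS]mulr1 -det_l -det_mulmx mulmx_block !mulmx1 !mulmx0 !add0r.
by rewrite !mulmxN !mulmxA mulmxV // mul1mx subrr det_ublock mulrC.
Qed.

(** Both sides equal [a ^+ n] times the determinant of [block_mx a%:M A B 1%:M]. Keeping the powers
    of [a] avoids dividing by it. *)
Lemma det_sylvester (R : comNzRingType) (m n : nat) (a : R) (A : 'M[R]_(m, n))
    (B : 'M_(n, m)) :
  a ^+ m * \det (a%:M - B *m A) = a ^+ n * \det (a%:M - A *m B).
Proof.
have detM : \det (block_mx a%:M A B 1%:M) = \det (a%:M - A *m B).
  have := det_lblock (1%:M : 'M[R]_m) (- B) (1%:M : 'M_n).
  rewrite !det1 mulr1 => det_l.
  rewrite -[LHS]mulr1 -[X in _ * X]det_l -det_mulmx mulmx_block.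
  rewrite !mulmx1 !mulmx0 !add0r.
  by rewrite mul1mx subrr det_ublock det1 mulr1 mulmxN.
have := det_lblock (1%:M : 'M[R]_m) (- B) (a%:M : 'M_n).
rewrite det1 mul1r det_scalar => det_l.
rewrite -detM -det_l -det_mulmx mulmx_block !mul1mx !mul0mx !addr0.
rewrite mulmx1 mulNmx mul_mx_scalar mul_scalar_mx addNr det_ublock det_scalar.
by rewrite mulNmx addrC.
Qed.

Lemma det_sub_char_poly (R L : comNzRingType) (phi : {rmorphism R -> L})
    (n : nat) (M : 'M[R]_n) (z : L) :
  \det (z%:M - map_mx phi M) = (map_poly phi (char_poly M)).[z].
Proof.
rewrite map_char_poly -[RHS]/(horner_eval z _) /char_poly -det_map_mx.
congr (\det _); apply/matrixP => i j; rewrite !mxE.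
by rewrite rmorphB rmorphMn /= /horner_eval hornerX hornerC.
Qed.

Definition fmx (R : Type) (S T : finType) (F : S -> T -> R) :
    'M[R]_(#|S|, #|T|) :=
  \matrix_(i, j) F (enum_val i) (enum_val j).

Lemma eq_fmx (R : Type) (S T : finType) (F F' : S -> T -> R) :
  F =2 F' -> fmx F = fmx F'.
Proof. by move=> eqF; apply/matrixP => i j; rewrite !mxE. Qed.

Lemma mulmx_fmx (R : pzSemiRingType) (S T U : finType) (F : S -> T -> R)
    (F' : T -> U -> R) :
  fmx F *m fmx F' = fmx (fun x z => \sum_y F x y * F' y z).
Proof.
apply/matrixP => i j; rewrite !mxE [RHS](reindex (fun k : 'I_#|T| => enum_val k)) /=.
  by apply: eq_bigr => k _; rewrite !mxE.
exact/onW_bij/enum_val_bij.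
Qed.

Lemma scalar_fmx (R : pzSemiRingType) (S : finType) (a : R) :
  a%:M = fmx (fun x y : S => a *+ (x == y)).
Proof. by apply/matrixP => i j; rewrite !mxE (inj_eq enum_val_inj). Qed.

Lemma det_fmx_sum (R : comNzRingType) (S T : finType)
    (F : (S + T)%type -> (S + T)%type -> R) :
  \det (fmx F) = \det (block_mx
    (fmx (fun x y => F (inl x) (inl y))) (fmx (fun x y => F (inl x) (inr y)))
    (fmx (fun x y => F (inr x) (inl y))) (fmx (fun x y => F (inr x) (inr y)))).
Proof.
pose h (i : 'I_#|S| + 'I_#|T|) : (S + T)%type :=
  match i with inl i => inl (enum_val i) | inr j => inr (enum_val j) end.
have inj_h : injective h by move=> [i|i] [j|j] // [/enum_val_inj->].
pose g k := enum_rank (h (split k)).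
have inj_g : injective g.
  by move=> i j /enum_rank_inj/inj_h/(congr1 unsplit); rewrite !splitK.
rewrite -(det_mxsub_bij _ _ inj_g) ?card_sum //; congr (\det _).
apply/matrixP => i j; rewrite !mxE /g !enum_rankK.
by case: (split i) => i'; rewrite !mxE; case: (split j) => j'; rewrite !mxE.
Qed.

Lemma Aalpha_fmx (R : pzRingType) (alpha : R) (G : sgraph) :
  Aalpha alpha G = fmx (fun x y : G =>
    alpha * (degree x)%:R *+ (x == y) + (1 - alpha) * (adj x y)%:R).
Proof.
apply/matrixP => i j; rewrite !mxE (inj_eq enum_val_inj).
by rewrite !mulrnAr.
Qed.

(** Over [R[i]] a monic polynomial is determined by its multiset of roots, and the embedding of [R]
    is injective on polynomials. *)
Lemma spectrum_char_poly (R : rcfType) (m n : nat) (M : 'M[R]_m) (N : 'M[R]_n) :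
  spectrum M = spectrum N <-> char_poly M = char_poly N.
Proof.
rewrite /spectrum -!map_char_poly; split=> [eqMN|-> //].
apply: (@map_poly_inj _ _ (real_complex R)).
case: (closed_field_poly_normal (map_poly _ (char_poly M))) eqMN => s /= ->.
case: (closed_field_poly_normal (map_poly _ (char_poly N))) => t /= -> eqst.
rewrite !lead_coef_map !(monicP (char_poly_monic _)) !rmorph1 !scale1r.
by apply: perm_big; apply/eq_seq_msetP.
Qed.

Lemma char_poly_size_eq (R : nzRingType) (m n : nat) (M : 'M[R]_m) (N : 'M[R]_n) :
  char_poly M = char_poly N -> m = n.
Proof.
by move/(congr1 (fun p : {poly R} => size p)); rewrite !size_char_poly => -[].
Qed.

Lemma det_block_schur_ul (F : fieldType) (m n : nat) (A : 'M[F]_m)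
    (B : 'M_(m, n)) (C : 'M_(n, m)) (D : 'M_n) :
  A \in unitmx ->
  \det (block_mx A B C D) = \det A * \det (D - C *m invmx A *m B).
Proof.
move=> uA; have := det_ublock (1%:M : 'M[F]_m) (- (invmx A *m B)) (1%:M : 'M_n).
rewrite !det1 mulr1 => det_u.
rewrite -[LHS]mulr1 -[X in _ * X]det_u -det_mulmx mulmx_block.
rewrite !mulmx1 !mulmx0 !addr0.
by rewrite !mulmxN !mulmxA mulmxV // mul1mx addNr det_lblock [_ + D]addrC.
Qed.

(** These are the entries of B B^T = D(G) + A(G): distinct vertices share at most the edge
    [[set v; w]]. *)
Lemma common_edge_count (G : sgraph) (v w : G) :
  (\sum_(e : edge G) (v \in val e) * (w \in val e))%N
  = (degree v * (v == w) + adj v w)%N.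
Proof.
have [<-|nvw] := eqVneq v w.
  rewrite adj_irrefl addn0 muln1 -incident_count.
  by apply: eq_bigr => e _; case: (v \in _).
rewrite muln0 add0n.
have ends (e : edge G) : (v \in val e) && (w \in val e) = (val e == [set v; w]).
  apply/andP/eqP => [[ve we]|->]; last by rewrite !inE !eqxx orbT.
  apply/esym/eqP; rewrite eqEcard card_edge cards2 nvw andbT.
  by apply/subsetP => x; rewrite !inE => /orP[] /eqP->.
under eq_bigr do rewrite mulnb ends.
have [vw|nadj] := boolP (adj v w); last first.
  rewrite big1 // => e _; case: eqP => // ee.
  by case: e ee => e /= ie ee; rewrite ee is_edge_pair (negbTE nadj) in ie.
have ee : is_edge [set v; w] by rewrite is_edge_pair.
pose e0 : edge G := exist (fun e : {set G} => is_edge e) _ ee.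
rewrite (bigD1 e0) //= eqxx big1 // => e ne.
by rewrite -[[set v; w]]/(val e0) (inj_eq val_inj) (negbTE ne).
Qed.

(** * Characteristic polynomial of the join *)

(* The block of [z - A_alpha] on the Q-graph after eliminating the vertices of
   [H], which only subtracts a constant [g] between any two inserted vertices;
   [d] is the degree of an inserted vertex. *)
Definition Qblock (L : pzRingType) (G : sgraph) (z a d g : L) (r : nat)
    (x y : (G + edge G)%type) : L :=
  match x, y with
  | inl v, inl w => (z - a * r%:R) *+ (v == w)
  | inl v, inr e | inr e, inl v => - ((1 - a) * (v \in val e)%:R)
  | inr e, inr f => (z - a * d) *+ (e == f)
                    - (1 - a) * (@Qgraph_adj G (inr e) (inr f))%:R - g
  end.

(** Schur complement on the block of [H]. The off-diagonal blocks are multiples of the indicator of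
    the inserted vertices times an all-ones vector, so there [invmx N] enters only through
    [Gamma]. *)
Lemma det_Qjoin (R : comNzRingType) (L : fieldType) (phi : {rmorphism R -> L})
    (alpha : R) (G H : sgraph) (r : nat) (x : L) :
  (forall v : G, degree v = r) ->
  let N := x%:M - map_mx phi (Aalpha alpha H) in
  let Gamma :=
    ((const_mx 1 : 'cV_#|H|)^T *m invmx N *m (const_mx 1 : 'cV_#|H|)) 0 0 in
  let z := x + phi alpha * #|edge G|%:R in
  N \in unitmx ->
  \det (z%:M - map_mx phi (Aalpha alpha (Qedge_join G H)))
  = \det N * \det (fmx (@Qblock L G z (phi alpha) (2 * r + #|H|)%:R
                         ((1 - phi alpha) ^+ 2 * Gamma) r)).
Proof.
move=> reg N Gamma z uN; set a := phi alpha in z *.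
have -> : z%:M - map_mx phi (Aalpha alpha (Qedge_join G H)) =
    fmx (fun s t : (G + edge G + H)%type => z *+ (s == t)
      - (a * (degree (s : Qedge_join G H))%:R *+ (s == t)
         + (1 - a) * (adj (s : Qedge_join G H) t)%:R)).
  rewrite Aalpha_fmx (@scalar_fmx _ (Qedge_join G H)).
  apply/matrixP => i j; rewrite !mxE.
  by rewrite rmorphD rmorphMn !rmorphM rmorphB rmorph1 !rmorph_nat.
rewrite det_fmx_sum.
set NH := fmx (fun s t : H => _); have -> : NH = N.
  rewrite /N Aalpha_fmx (@scalar_fmx _ H).
  apply/matrixP => i j; rewrite !mxE.
  rewrite rmorphD rmorphMn !rmorphM rmorphB rmorph1 !rmorph_nat.
  (* The shift in [z] absorbs the [#|edge G|] extra neighbours of each vertex of [H]. *)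
  rewrite degree_Qjoin_right natrD (inj_eq inr_inj) /z -/a.
  by case: (enum_val i == enum_val j); rewrite ?mulr0n ?mulr1n; ring.
rewrite det_block_schur //; congr (_ * \det _).
set UL := fmx _; set UR := fmx _; set DL := fmx _.
pose eps : 'cV[L]_#|{: G + edge G}| :=
  \col_i (if enum_val i is inr _ then 1 else 0).
have -> : UR = - (1 - a) *: (eps *m (const_mx 1)^T).
  apply/matrixP => i j; rewrite !mxE big_ord1 !mxE mulr1.
  by case: (enum_val i) => [v|e] /=; ring.
have -> : DL = - (1 - a) *: (const_mx 1 *m eps^T).
  apply/matrixP => i j; rewrite !mxE big_ord1 !mxE mul1r.
  by case: (enum_val j) => [v|e] /=; ring.
rewrite -!scalemxAl -!scalemxAr scalerA !mulmxA -[_ *m _ *m invmx N]mulmxA.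
rewrite -[eps *m _ *m const_mx 1]mulmxA [_ *m const_mx 1]mx11_scalar -/Gamma.
rewrite mul_mx_scalar -scalemxAl scalerA.
apply/matrixP => i j; rewrite !mxE big_ord1 !mxE.
case: (enum_val i) (enum_val j) => [v|e] [w|f] /=.
- rewrite degree_Qjoin_vertex reg !(inj_eq inl_inj).
  by case: (v == w); rewrite ?mulr0n ?mulr1n; ring.
- by ring.
- by ring.
rewrite (degree_Qjoin_edge _ _ reg) (inj_eq inl_inj) (inj_eq inr_inj).
by case: (e == f); rewrite ?mulr0n ?mulr1n /=; ring.
Qed.

(** Here [v] is the diagonal entry at the vertices of [G], and [y] the scalar part of the edge block
    once its adjacency is written as B^T B - 2. Eliminating [G] leaves B^T B subtracted
    [(1 - a) * t] times, and [w] is the eigenvalue of y - (1 - a) t B B^T at the all-ones vector. *)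
Lemma det_Qblock (R : comNzRingType) (L : fieldType) (phi : {rmorphism R -> L})
    (alpha : R) (G : sgraph) (r : nat) (z d g : L) :
  (forall v : G, degree v = r) -> 4%:R != 0 :> L ->
  let a := phi alpha in
  let v := z - a * r%:R in
  let y := z - a * d + 2%:R * (1 - a) in
  let t := 1 + (1 - a) / v in
  let w := y - 2%:R * r%:R * ((1 - a) * t) in
  v != 0 -> t != 0 -> w != 0 ->
  y ^+ #|G| * \det (fmx (@Qblock L G z a d g r))
  = v ^+ #|G| * (y ^+ #|edge G| * (t ^+ #|G| *
      (map_poly phi (char_poly (Aalpha alpha G))).[
        (y - (1 - a) * t * r%:R + t * a * r%:R) / t]
      * \det (1%:M - (2%:R * r%:R * (g / 4%:R) / w) *: const_mx 1 : 'M_#|G|))).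
Proof.
move=> reg n4 a v y t w nv nt nw.
pose s := (1 - a) * t; pose q := g / 4%:R.
pose B := fmx (fun (x : G) (e : edge G) => (x \in val e)%:R : L).
pose BT := fmx (fun (e : edge G) (x : G) => (x \in val e)%:R : L).
pose Q := fmx (fun x x' : G => r%:R *+ (x == x') + (adj x x')%:R : L).
pose J := const_mx 1 : 'M[L]_#|G|.
have BTB : BT *m B = fmx (fun e f : edge G =>
    (@Qgraph_adj G (inr e) (inr f))%:R + 2%:R *+ (e == f) : L).
  rewrite mulmx_fmx; apply: eq_fmx => e f.
  rewrite -mulrnA -natrD Qgraph_edge_adj -sum1_card [in RHS]big_mkcond natr_sum.
  by apply: eq_bigr => x _; rewrite inE -natrM; do 2!case: (x \in _).
have BBT : B *m BT = Q.
  rewrite mulmx_fmx; apply: eq_fmx => x x'.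
  rewrite -mulrnA -natrD -(reg x) -common_edge_count natr_sum.
  by apply: eq_bigr => e _; rewrite natrM.
have BTJ : BT *m J = const_mx 2%:R.
  apply/matrixP => i j; rewrite !mxE -(edge_count (enum_val i)) natr_sum.
  rewrite [RHS](reindex (fun k : 'I_#|G| => enum_val k)) /=.
    by apply: eq_bigr => k _; rewrite !mxE mulr1.
  exact/onW_bij/enum_val_bij.
have JB (c : L) : (const_mx c : 'M_(#|edge G|, #|G|)) *m B = const_mx (c * 2%:R).
  apply/matrixP => i j; rewrite !mxE -(edge_count (enum_val j)) natr_sum.
  rewrite [in RHS](reindex (fun k : 'I_#|G| => enum_val k)) /=.
    by rewrite big_distrr; apply: eq_bigr => k _; rewrite !mxE.
  exact/onW_bij/enum_val_bij.
have sumQ (x : G) :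
    \sum_(x' : G) (r%:R *+ (x == x') + (adj x x')%:R) = 2%:R * r%:R :> L.
  rewrite big_split /= -natr_sum -(degreeE x) (reg x).
  rewrite (bigD1 x) //= eqxx big1 => [|x' nx].
    by rewrite mulr1n; ring.
  by rewrite eq_sym (negbTE nx).
have QJ : Q *m J = (2%:R * r%:R) *: J.
  apply/matrixP => i j; rewrite !mxE mulr1 -(sumQ (enum_val i)).
  rewrite [RHS](reindex (fun k : 'I_#|G| => enum_val k)) /=.
    by apply: eq_bigr => k _; rewrite !mxE mulr1.
  exact/onW_bij/enum_val_bij.
have JQ : J *m Q = (2%:R * r%:R) *: J.
  apply: trmx_inj; rewrite trmx_mul linearZ /= trmx_const -QJ; congr (_ *m _).
  by apply/matrixP => i j; rewrite !mxE eq_sym adj_sym; case: eqP => // ->.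
have VV : fmx (fun x x' : G => Qblock z a d g r (inl x) (inl x')) = v%:M.
  by rewrite scalar_fmx.
have VE : fmx (fun (x : G) (e : edge G) => Qblock z a d g r (inl x) (inr e))
    = - (1 - a) *: B.
  by apply/matrixP => i j; rewrite !mxE /= mulNr.
have EV : fmx (fun (e : edge G) (x : G) => Qblock z a d g r (inr e) (inl x))
    = - (1 - a) *: BT.
  by apply/matrixP => i j; rewrite !mxE /= mulNr.
rewrite det_fmx_sum VV VE EV.
rewrite det_block_schur_ul; last by rewrite unitmxE det_scalar unitfE expf_neq0.
rewrite det_scalar mulrCA; congr (_ * _).
(* All entries of B^T J B are 4, hence the quarter in [q]. *)
set EE := _ - _; have -> : EE = y%:M - BT *m ((s%:M + q *: J) *m B).
  rewrite /EE invmx_scalar mul_mx_scalar -!scalemxAl -!scalemxAr.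
  rewrite mulmxDl mulmxDr mul_scalar_mx -scalemxAl -!scalemxAr mulmxA BTJ JB BTB.
  rewrite (@scalar_fmx _ (edge G)); apply/matrixP => i j; rewrite !mxE.
  set e := enum_val i; set f := enum_val j.
  rewrite /Qblock /q /s /y /t.
  by case: (e == f); rewrite ?mulr0n ?mulr1n; field; rewrite ?nv ?n4.
rewrite det_sylvester; congr (_ * _).
rewrite -mulmxA BBT mulmxDl mul_scalar_mx -scalemxAl JQ.
pose M := map_mx phi (Aalpha alpha G).
(* Since s A(G) = t (1 - a) A(G), the matrix A_alpha(G) appears without dividing by [1 - a], which
   vanishes for [alpha = 1]. *)
have W : t *: (((y - s * r%:R + t * a * r%:R) / t)%:M - M) = y%:M - s *: Q.
  rewrite /M Aalpha_fmx !(@scalar_fmx _ G); apply/matrixP => i j; rewrite !mxE.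
  rewrite rmorphD rmorphMn !rmorphM rmorphB rmorph1 !rmorph_nat reg -/a /s.
  by case: (enum_val i == enum_val j); rewrite ?mulr0n ?mulr1n; field.
(* By [QJ], y - s Q acts on [J] as the scalar [w], so the term in [J] splits off as a factor. *)
have -> : y%:M - (s *: Q + q *: (2%:R * r%:R *: J)) =
    t *: (((y - s * r%:R + t * a * r%:R) / t)%:M - M)
    *m (1%:M - (2%:R * r%:R * q / w) *: J).
  rewrite W mulmxBr mulmx1 -scalemxAr mulmxBl mul_scalar_mx -scalemxAl QJ.
  apply/matrixP => i j; rewrite !mxE /w -/s.
  by field.
by rewrite det_mulmx detZ det_sub_char_poly.
Qed.

(** * Degree of a regular graph from its spectrum *)

Lemma Aalpha_row_sum (R : pzRingType) (alpha : R) (G : sgraph) (r : nat)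
    (i : 'I_#|G|) :
  (forall x : G, degree x = r) -> \sum_j Aalpha alpha G i j = r%:R.
Proof.
move=> reg; rewrite Aalpha_fmx.
transitivity (\sum_(y : G) (alpha * (degree (enum_val i))%:R *+ (enum_val i == y)
    + (1 - alpha) * (adj (enum_val i) y)%:R)).
  rewrite [RHS](reindex (fun k : 'I_#|G| => enum_val k)) /=.
    by apply: eq_bigr => k _; rewrite !mxE.
  exact/onW_bij/enum_val_bij.
rewrite big_split /= -big_distrr -natr_sum /= -degreeE (bigD1 (enum_val i)) //=.
rewrite eqxx big1 => [|y ny]; last by rewrite eq_sym (negbTE ny).
by rewrite reg addr0 -mulrDl addrC subrK mul1r.
Qed.

Lemma Aalpha_sym (R : pzRingType) (alpha : R) (G : sgraph) i j :
  Aalpha alpha G i j = Aalpha alpha G j i.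
Proof.
by rewrite Aalpha_fmx !mxE eq_sym adj_sym; case: eqP => [->|].
Qed.

Lemma regular_eigenvalue (R : fieldType) (alpha : R) (G : sgraph) (r : nat) :
  (0 < #|G|)%N -> (forall x : G, degree x = r) ->
  root (char_poly (Aalpha alpha G)) r%:R.
Proof.
move=> G0 reg; rewrite -eigenvalue_root_char; apply/eigenvalueP.
exists (const_mx 1); last first.
  by apply/eqP => /matrixP/(_ 0 (Ordinal G0)) /eqP; rewrite !mxE oner_eq0.
(* [eigenvalue] concerns row vectors, so column sums are needed; symmetry turns them into row
   sums. *)
move: (Aalpha alpha G) (fun j => Aalpha_row_sum alpha j reg) (@Aalpha_sym R alpha G).
move=> A Asum Asym; apply/matrixP => i j; rewrite !mxE mulr1 -(Asum j).
by apply: eq_bigr => k _; rewrite !mxE mul1r Asym.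
Qed.

(** Compare the two sides of u A = x u at a coordinate where |u| is largest: the entries of A are
    nonnegative for alpha in [0,1], and each row sums to [r]. *)
Lemma regular_eigenvalue_le (R : realFieldType) (alpha : R) (G : sgraph)
    (r : nat) (x : R) :
  0 <= alpha -> alpha <= 1 -> (forall x : G, degree x = r) ->
  root (char_poly (Aalpha alpha G)) x -> x <= r%:R.
Proof.
move=> a0 a1 reg; rewrite -eigenvalue_root_char => /eigenvalueP[u uA /rV0Pn[i0 u0]].
pose j := [arg max_(i > i0) `|u 0 i|]%O.
have maxj k : `|u 0 k| <= `|u 0 j|.
  by rewrite /j; case: arg_maxP => // i _ /(_ k); apply.
have uj0 : 0 < `|u 0 j| by rewrite (lt_le_trans _ (maxj i0)) // normr_gt0.
apply: (le_trans (ler_norm x)); rewrite -(ler_pM2r uj0) -normrM.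
have /matrixP/(_ 0 j) := uA; rewrite mxE [RHS]mxE => <-.
apply: (le_trans (ler_norm_sum _ _ _)).
rewrite -(Aalpha_row_sum alpha j reg) big_distrl /=; apply: ler_sum => k _.
have A0 : 0 <= Aalpha alpha G j k.
  by rewrite Aalpha_fmx mxE addr_ge0 ?mulrn_wge0 ?mulr_ge0 ?ler0n ?subr_ge0.
by rewrite Aalpha_sym normrM mulrC (ger0_norm A0) ler_wpM2l.
Qed.

(** Both [r1] and [r2] are common eigenvalues, and neither exceeds the other. On empty graphs they
    are arbitrary, hence a conclusion about the vertices of [G2]. *)
Lemma cospectral_regular_degree (R : realFieldType) (alpha : R)
    (G1 G2 : sgraph) (r1 r2 : nat) :
  0 <= alpha -> alpha <= 1 ->
  (forall x : G1, degree x = r1) -> (forall x : G2, degree x = r2) ->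
  char_poly (Aalpha alpha G1) = char_poly (Aalpha alpha G2) ->
  forall x : G2, degree x = r1.
Proof.
move=> a0 a1 reg1 reg2 eqp x; have eqn := char_poly_size_eq eqp.
have G20 : (0 < #|G2|)%N by apply/card_gt0P; exists x.
have G10 : (0 < #|G1|)%N by rewrite eqn.
rewrite reg2; apply/eqP; rewrite eqn_leq -!(ler_nat R); apply/andP; split.
  apply: (regular_eigenvalue_le a0 a1 reg1); rewrite eqp.
  exact: regular_eigenvalue.
apply: (regular_eigenvalue_le a0 a1 reg2); rewrite -eqp.
exact: regular_eigenvalue.
Qed.

(** * Comparing joins over the field of rational functions *)

Lemma horner_map_tofrac (R : idomainType) (p q : {poly R}) :
  (map_poly ((@tofrac {poly R}) \o polyC) p).[tofrac q] = tofrac (p \Po q).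
Proof. by rewrite map_poly_comp horner_map. Qed.

Lemma comp_polyXaddC_inj (R : comNzRingType) (c : R) (p q : {poly R}) :
  p \Po ('X + c%:P) = q \Po ('X + c%:P) -> p = q.
Proof.
by move/(congr1 (comp_poly ('X - c%:P))); rewrite !comp_polyXaddC_K.
Qed.

Lemma XaddC_tofrac_neq0 (R : idomainType) (c : R) :
  tofrac ('X + c%:P) != 0 :> {fraction {poly R}}.
Proof. by rewrite tofrac_eq0 monic_neq0 // monicXaddC. Qed.

(* Evaluating at ['X + alpha m], for [m] the number of inserted vertices, turns
   the block of [H] into ['X%:M - Aalpha alpha H], the matrix in [coronal]. *)
Lemma Aalpha_Qjoin_char_poly (R : fieldType) (alpha : R) (G H : sgraph) (r : nat) :
  (forall v : G, degree v = r) ->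
  let c := alpha * #|edge G|%:R in
  let a := tofrac alpha%:P in
  tofrac (char_poly (Aalpha alpha (Qedge_join G H)) \Po ('X + c%:P))
  = tofrac (char_poly (Aalpha alpha H)) *
    \det (fmx (@Qblock {fraction {poly R}} G (tofrac ('X + c%:P)) a
           (2 * r + #|H|)%:R ((1 - a) ^+ 2 * coronal (Aalpha alpha H)) r)).
Proof.
move=> reg c a; pose phi : {rmorphism R -> {fraction {poly R}}} :=
  (@tofrac {poly R}) \o polyC.
have detH : \det ((tofrac 'X)%:M - map_mx phi (Aalpha alpha H))
    = tofrac (char_poly (Aalpha alpha H)).
  by rewrite det_sub_char_poly horner_map_tofrac comp_polyXr.
have zE : tofrac ('X + c%:P) = tofrac 'X + phi alpha * #|edge G|%:R.
  by rewrite tofracD -[_%:R](rmorph_nat phi) -rmorphM.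
rewrite -horner_map_tofrac -det_sub_char_poly zE (det_Qjoin reg) ?detH //.
by rewrite unitmxE detH unitfE tofrac_eq0 monic_neq0 // char_poly_monic.
Qed.

(** The first two hypotheses make [z] behave as an indeterminate, so that [v], [y], [t] and [w] of
    [det_Qblock] are nonzero and the power of [y] cancels. *)
Lemma det_Qblock_char_poly (R : numFieldType) (L : fieldType)
    (phi : {rmorphism R -> L}) (alpha : R) (G1 G2 : sgraph) (r d : nat)
    (z g : L) :
  (forall k, z + phi k != 0) ->
  (forall k l c, (z + phi k) * (z + phi l) != phi c) ->
  (forall v : G1, degree v = r) -> (forall v : G2, degree v = r) ->
  char_poly (Aalpha alpha G1) = char_poly (Aalpha alpha G2) ->
  \det (fmx (@Qblock L G1 z (phi alpha) d%:R g r))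
  = \det (fmx (@Qblock L G2 z (phi alpha) d%:R g r)).
Proof.
move=> lin0 quad0 reg1 reg2 eqp; have eqn := char_poly_size_eq eqp.
have eqm := eq_card_edge reg1 reg2 eqn.
set a := phi alpha.
have n4 : 4%:R != 0 :> L by rewrite -(rmorph_nat phi) fmorph_eq0 pnatr_eq0.
have vE : z - a * r%:R = z + phi (- (alpha * r%:R)).
  by rewrite rmorphN rmorphM rmorph_nat.
have v0 : z - a * r%:R != 0 by rewrite vE.
have yE : z - a * d%:R + 2%:R * (1 - a)
    = z + phi (2%:R * (1 - alpha) - alpha * d%:R).
  by rewrite rmorphB !rmorphM rmorphB rmorph1 !rmorph_nat -/a; ring.
have y0 : z - a * d%:R + 2%:R * (1 - a) != 0 by rewrite yE.
have t0 : 1 + (1 - a) / (z - a * r%:R) != 0.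
  have -> : 1 + (1 - a) / (z - a * r%:R)
      = (z + phi (1 - alpha - alpha * r%:R)) / (z - a * r%:R).
    by rewrite !rmorphB rmorph1 rmorphM rmorph_nat -/a; field.
  by rewrite mulf_neq0 ?invr_eq0.
have w0 : z - a * d%:R + 2%:R * (1 - a)
    - 2%:R * r%:R * ((1 - a) * (1 + (1 - a) / (z - a * r%:R))) != 0.
  (* In the notation of [det_Qblock], w v = (y - 2r(1 - a)) v - 2r(1 - a)^2, which [quad0] keeps
     from vanishing. *)
  pose c1 := 2%:R * (1 - alpha) - alpha * d%:R - 2%:R * r%:R * (1 - alpha).
  pose c2 := 2%:R * r%:R * (1 - alpha) ^+ 2.
  have -> : z - a * d%:R + 2%:R * (1 - a)
      - 2%:R * r%:R * ((1 - a) * (1 + (1 - a) / (z - a * r%:R)))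
      = ((z + phi c1) * (z + phi (- (alpha * r%:R))) - phi c2) / (z - a * r%:R).
    rewrite -vE /c1 /c2 !(rmorphB, rmorphM, rmorphXn) rmorph1 !rmorph_nat -/a.
    by field.
  by rewrite mulf_neq0 ?invr_eq0 // subr_eq0.
have D1 := det_Qblock g reg1 n4 v0 t0 w0.
have D2 := det_Qblock g reg2 n4 v0 t0 w0.
by apply: (mulfI (expf_neq0 #|G1| y0)); rewrite D1 [in RHS]eqn D2 eqp eqn eqm.
Qed.

Lemma char_poly_Qjoin_left (R : numFieldType) (alpha : R) (G1 G2 H : sgraph)
    (r : nat) :
  (forall v : G1, degree v = r) -> (forall v : G2, degree v = r) ->
  char_poly (Aalpha alpha G1) = char_poly (Aalpha alpha G2) ->
  char_poly (Aalpha alpha (Qedge_join G1 H))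
  = char_poly (Aalpha alpha (Qedge_join G2 H)).
Proof.
move=> reg1 reg2 eqp; have eqn := char_poly_size_eq eqp.
have eqm := eq_card_edge reg1 reg2 eqn.
pose c := alpha * #|edge G1|%:R; apply: (@comp_polyXaddC_inj _ c); apply/eqP.
have J1 := Aalpha_Qjoin_char_poly alpha H reg1.
have J2 := Aalpha_Qjoin_char_poly alpha H reg2.
rewrite -tofrac_eq J1 /c eqm J2; apply/eqP; congr (_ * _).
have lin (k l : R) : tofrac ('X + l%:P) + tofrac k%:P = tofrac ('X + (l + k)%:P).
  by rewrite polyCD addrA [in RHS]tofracD.
apply: (@det_Qblock_char_poly _ _ ((@tofrac {poly R}) \o polyC)) => // [k|k l c'].
  by rewrite /= lin XaddC_tofrac_neq0.
rewrite /= !lin -tofracM tofrac_eq.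
(* A product of two monic linear polynomials has size 3, a constant at most 1. *)
apply/eqP => /(congr1 (fun p : {poly R} => size p)) /eqP.
rewrite size_Mmonic ?monicXaddC ?monic_neq0 ?monicXaddC //.
by rewrite !size_XaddC size_polyC; case: (c' == 0).
Qed.

Theorem corollary4p3 (R : rcfType) (alpha : R)
    (alpha_ge0 : 0 <= alpha) (alpha_le1 : alpha <= 1) :
  (forall G1 G2 H : sgraph,
     regular G1 -> regular G2 ->
     Aalpha_cospectral alpha G1 G2 ->
     Aalpha_cospectral alpha (Qedge_join G1 H) (Qedge_join G2 H))
  /\
  (forall G H1 H2 : sgraph,
     regular G ->
     coronal (Aalpha alpha H1) = coronal (Aalpha alpha H2) ->
     Aalpha_cospectral alpha H1 H2 ->
     Aalpha_cospectral alpha (Qedge_join G H1) (Qedge_join G H2)).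
Proof.
split=> [G1 G2 H [r1 reg1] [r2 reg2]|G H1 H2 [r reg] eqc] [niso].
  move=> /spectrum_char_poly eqp.
  have reg2' := cospectral_regular_degree alpha_ge0 alpha_le1 reg1 reg2 eqp.
  split; last exact/spectrum_char_poly/(char_poly_Qjoin_left _ reg1 reg2').
  by move=> /(Qjoin_iso_left reg1 reg2' (char_poly_size_eq eqp)).
move=> /spectrum_char_poly eqp.
split; first by move=> /(Qjoin_iso_right reg reg erefl).
apply/spectrum_char_poly/(@comp_polyXaddC_inj _ (alpha * #|edge G|%:R))/eqP.
rewrite -tofrac_eq !(Aalpha_Qjoin_char_poly _ _ reg) eqp eqc.
(* The order of [H1] remains in the degree [2 * r + #|H1|] of the inserted vertices. *)
by rewrite (char_poly_size_eq eqp).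
Qed.
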